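(* Let $(\boldsymbol{U}^k_n)$ be generated by the stochastic parareal (SParareal) scheme (recalled in the context) for the ODE system $\frac{\mathrm{d}\boldsymbol{u}}{\mathrm{d}t}=\boldsymbol{f}(\boldsymbol{u}(t))$ on $[t_0,T]$, $\boldsymbol{u}(t_0)=\boldsymbol{u}_0\in\mathbb{R}^d$, with state-independent perturbations $\boldsymbol{\xi}^k_n(\boldsymbol{U}^k_n)=\boldsymbol{\xi}^k_n$. Assume: (1) (exact fine flow) $\boldsymbol{u}(t_{n+1})=\mathcal{F}_{\Delta T}(\boldsymbol{u}(t_n))$ for $0\le n\le N-1$; (2) (coarse flow) $\mathcal{G}_{\Delta T}$ is a one-step numerical method with uniform local truncation error $\mathcal{O}(\Delta T^{p+1})$, $p\ge 1$, in the sense that $\mathcal{F}_{\Delta T}(\boldsymbol{u})-\mathcal{G}_{\Delta T}(\boldsymbol{u})=c_1(\boldsymbol{u})\Delta T^{p+1}+c_2(\boldsymbol{u})\Delta T^{p+2}+\dots$ with continuously differentiable $c_i$, and there is a constant $C_1>0$ such that for all $\boldsymbol{u},\boldsymbol{v}\in\mathbb{R}^d$ $$\|(\mathcal{F}_{\Delta T}(\boldsymbol{u})-\mathcal{G}_{\Delta T}(\boldsymbol{u}))-(\mathcal{F}_{\Delta T}(\boldsymbol{v})-\mathcal{G}_{\Delta T}(\boldsymbol{v}))\|\le C_1\Delta T^{p+1}\|\boldsymbol{u}-\boldsymbol{v}\|;$$ (3) (Lipschitz coarse flow) there is $L_{\mathcal{G}}>0$ with $\|\mathcal{G}_{\Delta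 T}(\boldsymbol{u})-\mathcal{G}_{\Delta T}(\boldsymbol{v})\|\le L_{\mathcal{G}}\|\boldsymbol{u}-\boldsymbol{v}\|$ for all $\boldsymbol{u},\boldsymbol{v}\in\mathbb{R}^d$; (4) (bounded absolute moments) there are $q\ge 0$, $\tilde r\in\mathbb{N}\cup\{\infty\}$ with $\tilde r\ge 2$, and $C_2>0$ independent of $n$, $k$ and $\Delta T$ such that $\mathbb{E}[\|\boldsymbol{\xi}^k_n\|^r]\le (C_2\Delta T^{q+\frac12})^r$ for $1\le r\le\tilde r$. Then for all $2\le k<n\le N$ the mean-square error $e^k_n=\mathbb{E}[\|\boldsymbol{u}(t_n)-\boldsymbol{U}^k_n\|^2]$ satisfies $$e^k_n\le D A^{k-1}\sum_{\ell=0}^{n-k}\binom{\ell+k-1}{\ell}B^{\ell}+\Lambda\sum_{j=0}^{k-2}\sum_{\ell=0}^{n-(j+1)}\binom{\ell+j}{\ell}A^jB^{\ell},$$ where $A=C_1^2\Delta T^{2p+2}(2+\Delta T^{-1})$, $B=L_{\mathcal{G}}^2(1+2\Delta T)$, $\Lambda=C_2^2\Delta T^{2q+1}(2+\Delta T^{-1})$, $D=A\hat e^0$, and $\hat e^0=\max_{1\le n\le N}e^0_n$.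
   Context: $\|\cdot\|$ is the infinity norm on $\mathbb{R}^d$, $\|\boldsymbol{u}\|=\max_{i}|u_i|$, and $\mathbb{E}$ is expectation. The vector field $\boldsymbol{f}:\mathbb{R}^d\to\mathbb{R}^d$ is (possibly) nonlinear and smooth enough that the initial value problem has a unique solution $\boldsymbol{u}$ for all initial conditions of interest. The mesh is $t_n=t_0+n\Delta T$, $n=0,\dots,N$, with $\Delta T=(T-t_0)/N$. $\mathcal{F}_{\Delta T},\mathcal{G}_{\Delta T}:\mathbb{R}^d\to\mathbb{R}^d$ are two deterministic maps (the fine and coarse flow maps over one time slice of length $\Delta T$). SParareal scheme: $\boldsymbol{U}^0_0=\boldsymbol{u}_0$; $\boldsymbol{U}^0_{n+1}=\mathcal{G}_{\Delta T}(\boldsymbol{U}^0_n)$ for $0\le n\le N-1$; $\boldsymbol{U}^1_{n+1}=\mathcal{G}_{\Delta T}(\boldsymbol{U}^1_n)+\mathcal{F}_{\Delta T}(\boldsymbol{U}^0_n)-\mathcal{G}_{\Delta T}(\boldsymbol{U}^0_n)$ for $0\le n\le N-1$; $\boldsymbol{U}^{k+1}_{n+1}=\mathcal{G}_{\Delta T}(\boldsymbol{U}^{k+1}_n)+\mathcal{F}_{\Delta T}(\boldsymbol{U}^k_n)-\mathcal{G}_{\Delta T}(\boldsymbol{U}^k_n)+\boldsymbol{\xi}^k_n(\boldsymbol{U}^k_n)$ for $1\le k\le n\le N-1$, where the $\boldsymbol{\xi}^k_n(\boldsymbol{U}^k_n)$ are $\mathbb{R}^d$-valued random variables with $\boldsymbol{\xi}^k_n(\boldsymbol{U}^k_n)\equiv\boldsymbol{0}$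 when $n=k$. State-independent means that $\boldsymbol{\xi}^k_n$ does not depend on the state $\boldsymbol{U}^k_n$; the $\boldsymbol{\xi}^k_n$ need not be independent, identically distributed or centred. Convention: the scheme is exact up to $t_k$ after $k$ iterations, i.e. $\boldsymbol{U}^k_n=\boldsymbol{u}(t_n)$ for $0\le n\le k$ (in particular $\boldsymbol{U}^k_0=\boldsymbol{u}_0$ for all $k$). *)

(* Defs.v *)
From HB Require Import structures.
From mathcomp Require Import all_boot all_order all_algebra.
From mathcomp Require Import all_classical all_reals all_analysis.
Set Implicit Arguments.
Unset Strict Implicit.
Unset Printing Implicit Defensive.
Import Order.TTheory GRing.Theory Num.Theory.
Import numFieldNormedType.Exports.
Local Open Scope classical_set_scope.
Local Open Scope ring_scope.

(* R^d is 'rV[R]_d throughout; its library norm `|_| is the infinity norm. *)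

(* The derivative is taken relative to [t0, T], hence is one-sided at the two
   endpoints. *)
Definition ivp_solution (R : realType) (d : nat) (f : 'rV[R]_d -> 'rV[R]_d)
    (t0 T : R) (u0 : 'rV[R]_d) (u : R -> 'rV[R]_d) : Prop :=
  u t0 = u0 /\
  forall t, t \in `[t0, T] ->
    (s - t)^-1 *: (u s - u t) @[s --> within `[t0, T] t^'] --> f (u t).

Definition unique_ivp_solution (R : realType) (d : nat)
    (f : 'rV[R]_d -> 'rV[R]_d) (t0 T : R) (u0 : 'rV[R]_d)
    (u : R -> 'rV[R]_d) : Prop :=
  ivp_solution f t0 T u0 u /\
  forall v, ivp_solution f t0 T u0 v -> {in `[t0, T], v =1 u}.

Definition slice_length (R : realType) (t0 T : R) (N : nat) : R :=
  (T - t0) / N%:R.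

Definition mesh (R : realType) (t0 T : R) (N n : nat) : R :=
  t0 + n%:R * slice_length t0 T N.

Definition continuously_differentiable (R : realType) (d : nat)
    (c : 'rV[R]_d -> 'rV[R]_d) : Prop :=
  (forall v, differentiable c v) /\ continuous (jacobian c).

(* E h v = c_1(v) h^(p+1) + c_2(v) h^(p+2) + ... as an asymptotic expansion in
   the step length h -> 0+ : no convergence of the series is required. *)
Definition asymptotic_expansion (R : realType) (d p : nat)
    (E : R -> 'rV[R]_d -> 'rV[R]_d) (c : nat -> 'rV[R]_d -> 'rV[R]_d) : Prop :=
  let zero_right := (0 : R)^'+ in
  forall (v : 'rV[R]_d) (m : nat),
    (fun h => E h v - \sum_(1 <= i < m.+1) h ^+ (p + i) *: c i v)
      =O_zero_right (fun h => h ^+ (p + m.+1)).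

Definition truncation_expansion (R : realType) (d p : nat)
    (F G : R -> 'rV[R]_d -> 'rV[R]_d) : Prop :=
  exists c : nat -> 'rV[R]_d -> 'rV[R]_d,
    (forall i, (1 <= i)%N -> continuously_differentiable (c i)) /\
    asymptotic_expansion p (fun h v => F h v - G h v) c.

(* Componentwise measurability, i.e. Borel measurability as a map to R^d. *)
Definition random_vector (disp : measure_display) (Omega : measurableType disp)
    (R : realType) (d : nat) (X : Omega -> 'rV[R]_d) : Prop :=
  forall i, measurable_fun [set: Omega] (fun w => X w ord0 i).

(* U k n and xi k n carry the iteration number k first and the time index n
   second; F and G are the flow maps over one slice and v n stands for u(t_n).
   The perturbations may depend on the state here. *)
Record sparareal (disp : measure_display) (Omega : measurableType disp)
    (R : realType) (d N : nat) (F G : 'rV[R]_d -> 'rV[R]_d)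
    (u0 : 'rV[R]_d) (v : nat -> 'rV[R]_d)
    (xi : nat -> nat -> 'rV[R]_d -> Omega -> 'rV[R]_d)
    (U : nat -> nat -> Omega -> 'rV[R]_d) : Prop := Sparareal {
  sparareal_init : forall w, U 0%N 0%N w = u0 ;
  sparareal_coarse : forall n w, (n < N)%N ->
    U 0%N n.+1 w = G (U 0%N n w) ;
  sparareal_first : forall n w, (n < N)%N ->
    U 1%N n.+1 w = G (U 1%N n w) + F (U 0%N n w) - G (U 0%N n w) ;
  sparareal_next : forall k n w, (1 <= k <= n)%N -> (n < N)%N ->
    U k.+1 n.+1 w =
      G (U k.+1 n w) + F (U k n w) - G (U k n w) + xi k n (U k n w) w ;
  sparareal_exact : forall k n w, (n <= k)%N -> (n <= N)%N -> U k n w = v n ;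
  sparareal_perturbation : forall k n, (1 <= k <= n)%N -> (n < N)%N ->
    random_vector (fun w => xi k n (U k n w) w) ;
  sparareal_perturbation0 : forall k w, (1 <= k)%N -> (k < N)%N ->
    xi k k (U k k w) w = 0 }.

(* None stands for the order infinity. *)
Definition order_le (r : nat) (rmax : option nat) : Prop :=
  if rmax is Some m then (r <= m)%N else True.

Definition bounded_moments (disp : measure_display)
    (Omega : measurableType disp) (R : realType) (P : probability Omega R)
    (d N : nat) (dT q C2 : R) (rmax : option nat)
    (xi : nat -> nat -> Omega -> 'rV[R]_d) : Prop :=
  forall k n r, (1 <= k <= n)%N -> (n < N)%N -> (1 <= r)%N ->
    order_le r rmax ->
    ('E_P[fun w => (`|xi k n w| ^+ r)%R] <=
       ((C2 * dT `^ (q + 2^-1)) ^+ r)%:E)%E.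

Definition mean_square_error (disp : measure_display)
    (Omega : measurableType disp) (R : realType) (P : probability Omega R)
    (d : nat) (v : nat -> 'rV[R]_d) (U : nat -> nat -> Omega -> 'rV[R]_d)
    (k n : nat) : \bar R :=
  'E_P[fun w => (`|v n - U k n w| ^+ 2)%R]%E.

(* Main.v *)
Require Import Defs.
From HB Require Import structures.
From mathcomp Require Import all_boot all_order all_algebra.
From mathcomp Require Import all_classical all_reals all_analysis.
From mathcomp Require Import measurable_realfun ring lra.
Import Order.TTheory GRing.Theory Num.Theory.
Import numFieldNormedType.Exports.
Import HBNNSimple.
Local Open Scope classical_set_scope.
Local Open Scope ring_scope.

(** Subtracting the scheme from u(t_(n+1)) = F (u(t_n)) bounds the error of
    U^(k+1)_(n+1) by a + b + c, where a, b, c come from the Lipschitz bound of G,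
    the Lipschitz bound of F - G and the perturbation.  Young's inequality with
    weight dT gives (a + b + c)^2 <= (1 + 2 dT) a^2 + (2 + 1/dT) (b^2 + c^2),
    hence e^(k+1)_(n+1) <= B e^(k+1)_n + A e^k_n + Lambda, and e^k_k = 0.
    By Pascal's rule the claimed bound satisfies this recursion with equality. *)

(** The first [m] terms of the power series of $(1-B)^{-(k+1)}$. *)
Definition binom_sum (R : realType) (B : R) (k m : nat) : R :=
  \sum_(0 <= l < m) 'C(l + k, l)%:R * B ^+ l.

(* The bound for iteration k.+1; e0 stands for \hat e^0. *)
Definition parareal_bound (R : realType) (A B Lambda e0 : R) (k n : nat) : R :=
  e0 * A ^+ k.+1 * binom_sum R B k (n - k)
  + Lambda * \sum_(0 <= j < k) A ^+ j * binom_sum R B j (n - j).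

(* Majorants spare us the measurability of the iterates U^k_n. *)
Definition mean_majorized {disp : measure_display}
    {Omega : measurableType disp} {R : realType} (P : probability Omega R)
    (X : Omega -> R) (c : R) : Prop :=
  exists Y : Omega -> R, [/\ measurable_fun [set: Omega] Y,
    forall w, 0 <= Y w, forall w, X w <= Y w & ('E_P[Y] <= c%:E)%E].

(** * Recursions for the binomial sums and the bound *)

Lemma binom_sum_recr (R : realType) (B : R) (k m : nat) :
  binom_sum R B k.+1 m.+1 = binom_sum R B k m.+1 + B * binom_sum R B k.+1 m.
Proof.
rewrite /binom_sum big_nat_recl // [X in _ = X + _]big_nat_recl //.
rewrite !bin0 -addrA; congr (_ + _).
rewrite mulr_sumr -big_split /=; apply: eq_bigr => l _.
(* Pascal's rule splits each coefficient: one part lowers [k], the other lowers [l] and so carries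
   the extra factor [B]. *)
rewrite addSn binS natrD exprS addnS; ring.
Qed.

Lemma binom_sum0_recr (R : realType) (B : R) (m : nat) :
  binom_sum R B 0 m.+1 = 1 + B * binom_sum R B 0 m.
Proof.
rewrite /binom_sum big_nat_recl // bin0 expr0 mulr1 mulr_sumr.
congr (_ + _); apply: eq_bigr => l _.
rewrite !addn0 !binn exprS; ring.
Qed.

Lemma binom_sum_ge0 (R : realType) (B : R) (k m : nat) :
  0 <= B -> 0 <= binom_sum R B k m.
Proof. by move=> B0; apply: sumr_ge0 => l _; rewrite mulr_ge0 ?exprn_ge0. Qed.

Lemma parareal_bound_ge0 (R : realType) (A B Lambda e0 : R) (k n : nat) :
  0 <= A -> 0 <= B -> 0 <= Lambda -> 0 <= e0 ->
  0 <= parareal_bound R A B Lambda e0 k n.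
Proof.
move=> A0 B0 L0 e00; rewrite /parareal_bound addr_ge0 // mulr_ge0 //.
- by rewrite mulr_ge0 // exprn_ge0.
- exact: binom_sum_ge0.
- by apply: sumr_ge0 => j _; rewrite mulr_ge0 ?exprn_ge0 ?binom_sum_ge0.
Qed.

(** Models the first iteration: the scheme adds no perturbation there, hence no [Lambda], and the
    preceding error is replaced by the constant [e0]. *)
Lemma parareal_bound0_recr (R : realType) (A B Lambda e0 : R) (n : nat) :
  parareal_bound R A B Lambda e0 0 n.+1 =
  B * parareal_bound R A B Lambda e0 0 n + A * e0.
Proof.
by rewrite /parareal_bound !big_nil !subn0 binom_sum0_recr; ring.
Qed.

(** Since [k < n], the truncated differences [n - j] with [j <= k] are successors, so the recursion
    of the sums applies to each of them. *)
Lemma parareal_bound_recr (R : realType) (A B Lambda e0 : R) (k n : nat) :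
  (k < n)%N ->
  parareal_bound R A B Lambda e0 k.+1 n.+1 =
  B * parareal_bound R A B Lambda e0 k.+1 n
  + A * parareal_bound R A B Lambda e0 k n + Lambda.
Proof.
move=> kn; rewrite /parareal_bound subSS.
have -> : (n - k)%N = (n - k.+1).+1 by rewrite subnSK.
rewrite binom_sum_recr.
(* The geometric sum at [j = 0] produces the 1; in the later terms Pascal's rule turns [j.+1] into
   [j] at the price of one factor [A]. *)
have -> : \sum_(0 <= j < k.+1) A ^+ j * binom_sum R B j (n.+1 - j) =
    1 + B * (\sum_(0 <= j < k.+1) A ^+ j * binom_sum R B j (n - j))
    + A * (\sum_(0 <= j < k) A ^+ j * binom_sum R B j (n - j)).
  rewrite big_nat_recl // [X in 1 + B * X]big_nat_recl // !subn0 binom_sum0_recr.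
  rewrite !expr0 !mul1r mulrDr !addrA -[RHS]addrA; congr (_ + _).
  rewrite !mulr_sumr -big_split /=; apply: eq_big_nat => j /andP[_ jk].
  rewrite subSS -[(n - j)%N](subnSK (ltn_trans jk kn)) binom_sum_recr exprS.
  by rewrite (subnSK (ltn_trans jk kn)); ring.
by rewrite !exprS; ring.
Qed.

Lemma young_sqr3 (R : realType) (h a b c : R) : 0 < h ->
  (a + b + c) ^+ 2 <=
  (1 + 2 * h) * a ^+ 2 + (2 + h^-1) * (b ^+ 2 + c ^+ 2).
Proof.
move=> h0.
have young x y : 2 * (x * y) <= h * x ^+ 2 + h^-1 * y ^+ 2.
  rewrite -subr_ge0.
  have -> : h * x ^+ 2 + h^-1 * y ^+ 2 - 2 * (x * y) = h^-1 * (h * x - y) ^+ 2.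
    by field; rewrite gt_eqF.
  by rewrite mulr_ge0 ?sqr_ge0 // invr_ge0 ltW.
(* The products [a * b] and [a * c] cost [2 * h] on [a ^+ 2] and [h^-1] on the other squares;
   [b * c] costs one more of each of those, whence [2 + h^-1]. *)
have := young a b; have := young a c; have := sqr_ge0 (b - c); nra.
Qed.

(** * Expectations and measurable majorants *)

Lemma ge0_le_integral_nonmeas {disp : measure_display}
    {Omega : measurableType disp} {R : realType}
    (mu : {measure set Omega -> \bar R}) (f g : Omega -> \bar R) :
  (forall w, (0 <= f w)%E) -> (forall w, (f w <= g w)%E) ->
  (\int[mu]_w f w <= \int[mu]_w g w)%E.
Proof.
(* Each integral is a supremum over the simple functions below the integrand, and those below [f]
   are also below [g]. *)
move=> f0 fg; rewrite !ge0_integralTE //; last first.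
  by move=> w; apply: le_trans (fg w).
apply: ge_ereal_sup => _ [h /= hf <-].
by apply: ereal_sup_ubound; exists h => // w; apply: le_trans (fg w).
Qed.

Section mean_majorized_theory.
Context {disp : measure_display} {Omega : measurableType disp} {R : realType}.
Variable P : probability Omega R.
Implicit Types (X Y : Omega -> R) (a b c : R).

Lemma expectation_le_majorized X c : (forall w, 0 <= X w) ->
  mean_majorized P X c -> ('E_P[X] <= c%:E)%E.
Proof.
move=> X0 [Y [mY Y0 XY]]; apply: le_trans.
by rewrite unlock; apply: ge0_le_integral_nonmeas => w; rewrite lee_fin.
Qed.

Lemma mean_majorized_le X Y c : (forall w, X w <= Y w) ->
  mean_majorized P Y c -> mean_majorized P X c.
Proof.
move=> XY [Z [mZ Z0 YZ Zc]]; exists Z; split=> // w.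
exact: le_trans (XY w) (YZ w).
Qed.

Lemma mean_majorized_self X c : measurable_fun [set: Omega] X ->
  (forall w, 0 <= X w) -> ('E_P[X] <= c%:E)%E -> mean_majorized P X c.
Proof. by move=> mX X0 Xc; exists X. Qed.

Lemma mean_majorized_cst a : 0 <= a -> mean_majorized P (cst a) a.
Proof. by move=> a0; apply: mean_majorized_self; rewrite ?expectation_cst. Qed.

Lemma mean_majorizedZ X a c : 0 <= a -> mean_majorized P X c ->
  mean_majorized P (fun w => a * X w) (a * c).
Proof.
move=> a0 [Y [mY Y0 XY Yc]]; exists (fun w => a * Y w); split.
- exact: measurable_funM.
- by move=> w; rewrite mulr_ge0.
- by move=> w; rewrite ler_wpM2l.
- move: Yc; rewrite unlock => Yc.
  under eq_integral do rewrite EFinM.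
  rewrite ge0_integralZl ?lee_fin //.
  + by rewrite EFinM lee_pmul ?lee_fin // integral_ge0 // => w _; rewrite lee_fin.
  + exact/measurable_EFinP.
  + by move=> w _; rewrite lee_fin.
Qed.

(** Additivity of the integral is used for the majorants only, which are measurable. *)
Lemma mean_majorizedD X Y a b : mean_majorized P X a -> mean_majorized P Y b ->
  mean_majorized P (fun w => X w + Y w) (a + b).
Proof.
move=> [X' [mX X0 XX Xa]] [Y' [mY Y0 YY Yb]].
exists (fun w => X' w + Y' w); split.
- exact: measurable_funD.
- by move=> w; rewrite addr_ge0.
- by move=> w; rewrite lerD.
- move: Xa Yb; rewrite unlock => Xa Yb.
  under eq_integral do rewrite EFinD.
  rewrite ge0_integralD //.
  + by rewrite EFinD leeD.
  + by move=> w _; rewrite lee_fin.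
  + exact/measurable_EFinP.
  + by move=> w _; rewrite lee_fin.
  + exact/measurable_EFinP.
Qed.

End mean_majorized_theory.

Lemma measurable_mx_norm {disp : measure_display}
    {Omega : measurableType disp} {R : realType} (d : nat)
    (X : Omega -> 'rV[R]_d) :
  random_vector X -> measurable_fun [set: Omega] (fun w => `|X w|).
Proof.
move=> mX.
(* The infinity norm is a finite maximum of absolute values of coordinates. *)
have -> : (fun w => `|X w|) =
    (fun w => \big[Num.max/0]_(ij : 'I_1 * 'I_d) `|X w ij.1 ij.2|).
  by apply/funext => w; rewrite -mx_normrE.
elim: (index_enum _) => [|ij s IH].
  by under eq_fun do rewrite big_nil; exact: measurable_cst.
under eq_fun do rewrite big_cons.
apply: measurable_maxr => //; apply: measurableT_comp => //.
rewrite (ord1 ij.1); exact: mX.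
Qed.

(** * Propagation of the error along the scheme *)

Section sparareal_error.
Context {disp : measure_display} {Omega : measurableType disp} {R : realType}.
Variables (P : probability Omega R) (d N : nat) (F G : 'rV[R]_d -> 'rV[R]_d).
Variables (u0 : 'rV[R]_d) (v : nat -> 'rV[R]_d).
Variables (xi U : nat -> nat -> Omega -> 'rV[R]_d).
Hypothesis scheme : sparareal N F G u0 v (fun k n _ => xi k n) U.

Lemma sparareal_coarse_iter n w : (n <= N)%N -> U 0 n w = iter n G u0.
Proof.
elim: n => [_|n IH nN]; first exact: sparareal_init scheme w.
by rewrite (sparareal_coarse scheme) // IH // ltnW.
Qed.

(** Iteration 0 is deterministic, so its error is a constant random variable. *)
Lemma coarse_mean_square_error n : (n <= N)%N ->
  mean_square_error P v U 0 n = (`|v n - iter n G u0| ^+ 2)%:E.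
Proof.
move=> nN; rewrite /mean_square_error -(expectation_cst P).
by congr ('E_P[_]%E); apply/funext => w /=; rewrite sparareal_coarse_iter.
Qed.

Variables (h C L : R).
Hypotheses (h0 : 0 < h) (C0 : 0 <= C) (L0 : 0 <= L).
Hypothesis exact_fine : forall n, (n < N)%N -> v n.+1 = F (v n).
Hypothesis defect_lip : forall x y,
  `|(F x - G x) - (F y - G y)| <= C * `|x - y|.
Hypothesis coarse_lip : forall x y, `|G x - G y| <= L * `|x - y|.

(** With [C] equal to $C_1\Delta T^{p+1}$ this is the $A$ of the theorem. *)
Let A := C ^+ 2 * (2 + h^-1).
Let B := L ^+ 2 * (1 + 2 * h).

Lemma sparareal_error_step n (x y z xi_kn : 'rV[R]_d) : (n < N)%N ->
  z = G x + F y - G y + xi_kn ->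
  `|v n.+1 - z| ^+ 2 <= B * `|v n - x| ^+ 2 + A * `|v n - y| ^+ 2
    + (2 + h^-1) * `|xi_kn| ^+ 2.
Proof.
move=> nN ->; rewrite exact_fine //.
(* Inserting [G (v n)] separates the coarse flow, the defect [F - G] and the perturbation. *)
have -> : F (v n) - (G x + F y - G y + xi_kn) =
    (G (v n) - G x) + ((F (v n) - G (v n)) - (F y - G y)) - xi_kn.
  rewrite opprD addrA; congr (_ - xi_kn).
  by rewrite [RHS]addrA [G (v n) - _ + _]addrC subrKA -[G x + _ - _]addrA opprD addrA.
have le_sum : `|(G (v n) - G x) + ((F (v n) - G (v n)) - (F y - G y)) - xi_kn|
    <= L * `|v n - x| + C * `|v n - y| + `|xi_kn|.
  apply: le_trans (ler_normB _ _) _; rewrite lerD2r.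
  by apply: le_trans (ler_normD _ _) _; rewrite lerD.
have := young_sqr3 R h (L * `|v n - x|) (C * `|v n - y|) `|xi_kn| h0.
have : `|(G (v n) - G x) + ((F (v n) - G (v n)) - (F y - G y)) - xi_kn| ^+ 2
    <= (L * `|v n - x| + C * `|v n - y| + `|xi_kn|) ^+ 2.
  by rewrite ler_sqr ?nnegrE // !addr_ge0 ?mulr_ge0.
move=> /le_trans/[apply] /le_trans; apply.
rewrite /A /B !exprMn le_eqVlt; apply/orP; left; apply/eqP; ring.
Qed.

Variables (e0 Lambda : R).
Hypotheses (e00 : 0 <= e0) (Lambda0 : 0 <= Lambda).
Hypothesis coarse_error : forall n, (n <= N)%N ->
  `|v n - iter n G u0| ^+ 2 <= e0.
Hypothesis perturbation_bound : forall k n, (1 <= k <= n)%N -> (n < N)%N ->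
  mean_majorized P (fun w => (2 + h^-1) * `|xi k n w| ^+ 2) Lambda.

(** Induction on the iteration, and within it on time; the pathwise step becomes the recursion of
    the bound. *)
Lemma sparareal_error_majorized k n : (n <= N)%N ->
  mean_majorized P (fun w => `|v n - U k.+1 n w| ^+ 2)
    (parareal_bound R A B Lambda e0 k n).
Proof.
have A0 : 0 <= A by rewrite mulr_ge0 ?sqr_ge0 // addr_ge0 // invr_ge0 ltW.
have B0 : 0 <= B by rewrite mulr_ge0 ?sqr_ge0 // addr_ge0 // mulr_ge0 // ltW.
(* Where the scheme is exact the error vanishes, and nonnegativity of the bound suffices. *)
have exact_majorized j m : (m <= j.+1)%N -> (m <= N)%N ->
    mean_majorized P (fun w => `|v m - U j.+1 m w| ^+ 2)
      (parareal_bound R A B Lambda e0 j m).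
  move=> mj mN; apply: (mean_majorized_le _ _ (cst _)) => [w|]; last first.
    exact/mean_majorized_cst/parareal_bound_ge0.
  rewrite (sparareal_exact scheme) // subrr normr0 expr0n /=.
  exact: parareal_bound_ge0.
elim: k n => [|k IHk] n; elim: n => [|n IHn] nN; try exact: exact_majorized.
  rewrite parareal_bound0_recr.
  have := mean_majorizedD P _ _ _ _ (mean_majorizedZ P _ _ _ B0 (IHn (ltnW nN)))
    (mean_majorized_cst P _ (mulr_ge0 A0 e00)).
  apply: mean_majorized_le => w /=.
  (* The first iteration is a step with perturbation 0. *)
  have := @sparareal_error_step n (U 1%N n w) (U 0%N n w) (U 1%N n.+1 w) 0 nN.
  rewrite addr0 (sparareal_first scheme) // => /(_ erefl).
  rewrite normr0 expr0n /= mulr0 addr0 => /le_trans; apply.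
  by rewrite lerD2l ler_wpM2l // sparareal_coarse_iter ?coarse_error // ltnW.
(* Either the new time index lies in the exact range, or [k.+1 < n] and the perturbed step of the
   scheme applies. *)
have [nk|kn] := leqP n.+1 k.+2; first exact: exact_majorized.
rewrite parareal_bound_recr; last exact: ltnW kn.
have kn' : (1 <= k.+1 <= n)%N by rewrite /= ltnW.
have := mean_majorizedD P _ _ _ _ (mean_majorizedD P _ _ _ _
  (mean_majorizedZ P _ _ _ B0 (IHn (ltnW nN)))
  (mean_majorizedZ P _ _ _ A0 (IHk n (ltnW nN)))) (perturbation_bound _ _ kn' nN).
apply: mean_majorized_le => w.
apply: sparareal_error_step => //.
by rewrite (sparareal_next scheme).
Qed.

End sparareal_error.

(** * Perturbation moments and the initial error *)

Lemma perturbation_majorized {disp : measure_display}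
    {Omega : measurableType disp} {R : realType} (P : probability Omega R)
    (d N : nat) (h q C : R) (rmax : option nat)
    (xi : nat -> nat -> Omega -> 'rV[R]_d) (k n : nat) :
  0 < h -> order_le 2 rmax -> bounded_moments P N h q C rmax xi ->
  (1 <= k <= n)%N -> (n < N)%N -> random_vector (xi k n) ->
  mean_majorized P (fun w => (2 + h^-1) * `|xi k n w| ^+ 2)
    (C ^+ 2 * h `^ (2 * q + 1) * (2 + h^-1)).
Proof.
move=> h0 r2 moments kn nN mxi; rewrite [X in mean_majorized _ _ X]mulrC.
apply: mean_majorizedZ; first by rewrite addr_ge0 // invr_ge0 ltW.
apply: mean_majorized_self => [|w|].
- exact/measurable_funX/measurable_mx_norm.
- exact: sqr_ge0.
(* The moment of order 2 enters here; squaring $h^{q+1/2}$ gives $h^{2q+1}$. *)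
- apply: le_trans (moments k n 2%N kn nN _ r2) _ => //.
  rewrite lee_fin exprMn ler_wpM2l ?sqr_ge0 //.
  rewrite -powR_mulrn ?powR_ge0 // -powRrM mulrDl mulVf //.
  by rewrite [q * _]mulrC.
Qed.

(** For [0 < N] the range is nonempty, so the default value [-oo] is absorbed and the maximum is a
    real number. *)
Lemma bigmaxe_fin_num {R : realType} (N : nat) (x : nat -> R) : (0 < N)%N ->
  exists e : R, \big[maxe/-oo%E]_(1 <= n < N.+1) (x n)%:E = e%:E /\
    forall n, (1 <= n <= N)%N -> x n <= e.
Proof.
elim: N => // -[|N] IH _.
  by exists (x 1%N); rewrite big_nat1_id maxeNy; split=> // -[|[]].
have [//|e [He Hx]] := IH.
exists (Num.max e (x N.+2)); rewrite big_nat_recr //= He -EFin_max; split=> //.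
move=> n /andP[n0]; rewrite leq_eqVlt le_max => /predU1P[->|nN].
  by rewrite lexx orbT.
by rewrite Hx ?n0.
Qed.

Theorem theorem4p6 (R : realType) (d : nat)
    (disp : measure_display) (Omega : measurableType disp)
    (P : probability Omega R)
    (f : 'rV[R]_d -> 'rV[R]_d) (t0 T : R) (ht : t0 < T)
    (u0 : 'rV[R]_d) (u : R -> 'rV[R]_d)
    (hu : unique_ivp_solution f t0 T u0 u)
    (F G : R -> 'rV[R]_d -> 'rV[R]_d)
    (p : nat) (hp : (1 <= p)%N) (hexp : truncation_expansion p F G)
    (C1 LG C2 q : R) (hC1 : 0 < C1) (hLG : 0 < LG) (hC2 : 0 < C2) (hq : 0 <= q)
    (rmax : option nat) (hr : order_le 2 rmax)
    (N : nat) (hN : (0 < N)%N)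
    (xi U : nat -> nat -> Omega -> 'rV[R]_d) :
  let dT := slice_length t0 T N in
  let ut := fun n => u (mesh t0 T N n) in
  sparareal N (F dT) (G dT) u0 ut (fun k n _ => xi k n) U ->
  (forall n, (n < N)%N -> ut n.+1 = F dT (ut n)) ->
  (forall v w, `|(F dT v - G dT v) - (F dT w - G dT w)|
     <= C1 * dT ^+ p.+1 * `|v - w|) ->
  (forall v w, `|G dT v - G dT w| <= LG * `|v - w|) ->
  bounded_moments P N dT q C2 rmax xi ->
  let A := C1 ^+ 2 * dT ^+ (2 * p + 2) * (2 + dT^-1) in
  let B := LG ^+ 2 * (1 + 2 * dT) in
  let Lambda := C2 ^+ 2 * dT `^ (2 * q + 1) * (2 + dT^-1) in
  let e := mean_square_error P ut U in
  let ehat0 := \big[maxe/-oo%E]_(1 <= n < N.+1) e 0%N n in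
  let D := (A%:E * ehat0)%E in
  forall k n : nat, (2 <= k)%N -> (k < n)%N -> (n <= N)%N ->
  (e k n <=
     D * (A ^+ (k - 1)
          * \sum_(0 <= l < (n - k).+1) 'C(l + k - 1, l)%:R * B ^+ l)%:E
     + (Lambda * \sum_(0 <= j < (k - 2).+1) \sum_(0 <= l < (n - j.+1).+1)
          'C(l + j, l)%:R * A ^+ j * B ^+ l)%:E)%E.
Proof.
move=> dT ut scheme fine defect coarse moments A B Lambda e ehat0 D k n k2 kn nN.
have h0 : 0 < dT by rewrite divr_gt0 ?subr_gt0 ?ltr0n.
have [e0 [He0 Hx]] := bigmaxe_fin_num N
  (fun n => `|ut n - iter n (G dT) u0| ^+ 2) hN.
have ehatE : ehat0 = e0%:E.
  rewrite /ehat0 -He0; apply: eq_big_nat => m /andP[_ mN].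
  by rewrite /e (coarse_mean_square_error P _ _ _ _ _ _ _ _ scheme).
have e00 : 0 <= e0 by apply: le_trans (Hx 1%N _); rewrite ?sqr_ge0 // hN.
have coarse_error m : (m <= N)%N -> `|ut m - iter m (G dT) u0| ^+ 2 <= e0.
  case: m => [_|m mN]; last exact: Hx.
  (* Time 0 lies outside the maximum, but there the error is zero. The scheme speaks of outcomes, so
     one is needed: total mass 1 excludes an empty [Omega]. *)
  have [w] : exists w : Omega, True.
    apply: contrapT => noO.
    have := probability_setT P.
    have -> : [set: Omega] = set0 by apply/seteqP; split=> // w; case: noO; exists w.
    by rewrite measure0 => /eqP; rewrite lt_eqF ?lte_fin ?ltr01.
  move=> _; rewrite -(sparareal_exact scheme w (leqnn 0) (leq0n N)).
  by rewrite (sparareal_init scheme) subrr normr0 expr0n.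
have Lambda0 : 0 <= Lambda.
  apply: mulr_ge0; first by rewrite mulr_ge0 ?sqr_ge0 ?powR_ge0.
  by rewrite addr_ge0 // invr_ge0 ltW.
have C0 : 0 <= C1 * dT ^+ p.+1 by rewrite mulr_ge0 ?exprn_ge0 // ltW.
have pert k' n' (kn' : (1 <= k' <= n')%N) (nN' : (n' < N)%N) :=
  perturbation_majorized P d N dT q C2 rmax xi k' n' h0 hr moments kn' nN'
    (sparareal_perturbation scheme kn' nN').
(* Index [k.-1] of the bound belongs to iteration [k]. *)
have := sparareal_error_majorized P d N (F dT) (G dT) u0 ut xi U scheme
  dT _ _ h0 C0 (ltW hLG) fine defect coarse e0 Lambda e00 Lambda0 coarse_error pert
  k.-1 n nN.
rewrite (prednK (ltnW k2)) => /(expectation_le_majorized P) => /(_ _)/le_trans.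
apply; first by move=> w; exact: sqr_ge0.
have AE : (C1 * dT ^+ p.+1) ^+ 2 * (2 + dT^-1) = A.
  by rewrite /A exprMn -exprM [(p.+1 * 2)%N]mulnC mulnS addnC.
rewrite AE -/B /D ehatE -!EFinM -EFinD lee_fin /parareal_bound.
case: k k2 kn => [|[|k]] // _ kn; rewrite /= subn1 subn2 /=.
(* The two bounds coincide: [D] holds one factor [A], and the inner ranges agree because [n - j] is
   [(n - j.+1).+1]. *)
rewrite le_eqVlt; apply/orP; left; apply/eqP; congr (_ + _ * _).
  rewrite exprS /binom_sum subnSK; last exact: ltnW.
  under [in RHS]eq_bigr do rewrite -addnBA // subn1.
  by rewrite /=; ring.
apply: eq_big_nat => j /andP[_ jk].
rewrite /binom_sum mulr_sumr subnSK; last first.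
  exact: leq_trans jk (ltnW (ltnW kn)).
by apply: eq_bigr => l _; rewrite mulrCA mulrA.
Qed.
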